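(* Consider a general-type company with agency-cost function $\rho(\cdot)$, market price $P_{T_2}$, threshold $\bar s(c)=\frac{c-\rho(c)}{1-\rho(c)}$ and liquidity index $ILL_{s_0}(c,\lambda)\in[0,+\infty]$ as defined in the context. Then: (i) (Noise traders' participation increases liquidity.) For every $c\in(0,1)$, every $s_0\in[0,\bar s(c))$ and all $0\le\lambda_1<\lambda_2$, $$ILL_{s_0}(c,\lambda_1)<ILL_{s_0}(c,\lambda_2).$$ (ii) (Improving governance increases liquidity when $\lambda\neq0$.) For every $\lambda>0$, all $0<c_2<c_1<1$ and every $s_0\in[0,\bar s(c_1))$, $$ILL_{s_0}(c_2,\lambda)>ILL_{s_0}(c_1,\lambda).$$
   Context: Fixed data: a real $\bar V>0$ (value of a share without agency cost), integers $N_I\ge0$ (number of informed traders) and $M\ge1$ (number of deals) with $M\ge N_I$, and $\Delta T>0$. Agency cost (general-type company): $\theta\in(0,1)$ and $f:(0,1)\to(0,\infty)$ is twice differentiable with $f'>0$ and $f''<0$. The agency cost of a company with governance parameter $c\in(0,1)$ (smaller $c$ means better governance) is $\rho(c)=\frac{1-\theta}{2}f(c)$, and it is assumed that $0\le\rho(c)\le c$ for all $c\in(0,1)$. Market model for given $c\in(0,1)$ and $\lambda\ge0$ (degree of noise traders' participation): write $\rho=\rho(c)$, $V(\rho)=(1-\rho)\bar V$ (fair value of a share) and $\underline V=(1-c)\bar V$. The number $N_U$ of participating noise traders is Poisson distributed with parameter $\lambda\Delta T$ ($N_U=0$ a.s. if $\lambda=0$). Each noise trader has an estimate of the share value; the estimates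 are i.i.d. uniform on $[\underline V,\bar V]$ and independent of $N_U$. Each of the $N_I$ informed traders has estimate $V(\rho)$. Let $N=N_I+N_U$ and let $\hat V^{(1)}\ge\dots\ge\hat V^{(N)}$ be all $N$ estimates in descending order. The market price after the $M$ deals is $$P_{T_2}=\hat V^{(M+1)}\ \text{ if } N>M,\qquad P_{T_2}=\underline V\ \text{ if } N\le M.$$ Let $\bar s(c)=\frac{c-\rho(c)}{1-\rho(c)}$. For $s_0\in[0,1)$ let $F_{s_0}(c,\lambda)=\Pr[P_{T_2}<(1-s_0)V(\rho)]$, and let $ILL_{s_0}(c,\lambda)=-\ln F_{s_0}(c,\lambda)$ if $F_{s_0}(c,\lambda)>0$ and $ILL_{s_0}(c,\lambda)=+\infty$ if $F_{s_0}(c,\lambda)=0$. A larger $ILL_{s_0}$ means higher liquidity. *)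

(* Defs.v *)
From HB Require Import structures.
From mathcomp Require Import all_boot all_order all_algebra.
From mathcomp Require Import all_classical all_reals all_analysis.

Set Implicit Arguments.
Unset Strict Implicit.
Unset Printing Implicit Defensive.

Import Order.TTheory GRing.Theory Num.Theory.
Import numFieldNormedType.Exports.

Local Open Scope classical_set_scope.
Local Open Scope ring_scope.

Definition agency_cost (R : realType) (theta : R) (f : R -> R) (c : R) : R :=
  (1 - theta) / 2 * f c.

Definition fair_value (R : realType) (Vbar rho : R) : R := (1 - rho) * Vbar.

Definition lower_value (R : realType) (Vbar c : R) : R := (1 - c) * Vbar.

Definition s_bar (R : realType) (rho : R -> R) (c : R) : R :=
  (c - rho c) / (1 - rho c).

Definition mutually_independent d (T : measurableType d) (R : realType)
    (P : probability T R) (I : choiceType) (G : I -> set (set T)) : Prop :=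
  forall (J : seq I) (E : I -> set T),
    uniq J -> (forall i, i \in J -> G i (E i)) ->
    P (\bigcap_(i in [set` J]) E i) = (\prod_(i <- J) P (E i))%E.

(* The second argument [0%N] of [poisson_prob] is a dummy of the library's
   definition; for a zero rate [poisson_prob] is the Dirac mass at 0.
   The estimates form an infinite i.i.d. sequence, of which the first
   [noise_count] terms belong to the participating noise traders; [None]
   indexes the number of noise traders in the independence clause. *)
Record market (R : realType) (Vbar dT c lambda : R) := Market {
  market_display : measure_display;
  outcome : measurableType market_display;
  Pr : probability outcome R;
  noise_count : {RV Pr >-> nat};
  noise_estimate : nat -> {RV Pr >-> R};
  noise_count_poisson : forall A : set nat, measurable A ->
    distribution Pr noise_count A = poisson_prob (lambda * dT) 0%N A;
  noise_estimate_uniform : exists ab : lower_value Vbar c < Vbar,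
    forall (i : nat) (A : set R), measurable A ->
      distribution Pr (noise_estimate i) A = uniform_prob ab A;
  noise_independent : mutually_independent Pr
    (fun o : option nat =>
       if o is Some i then g_sigma_algebra_preimage (noise_estimate i)
       else g_sigma_algebra_preimage noise_count)
}.

Section liquidity.
Context (R : realType) (rho : R -> R) (NI M : nat) (s0 : R).
Context (Vbar dT c lambda : R) (m : market Vbar dT c lambda).

Definition estimates (w : outcome m) : seq R :=
  nseq NI (fair_value Vbar (rho c)) ++
  [seq noise_estimate m i w | i <- iota 0 (noise_count m w)].

(* Indexing starts at 0, so the (M+1)-th largest estimate has index [M]. *)
Definition market_price (w : outcome m) : R :=
  let s := sort >=%R (estimates w) in
  if (M < size s)%N then s`_M else lower_value Vbar c.

Definition low_price_prob : R :=
  fine (Pr m [set w | market_price w < (1 - s0) * fair_value Vbar (rho c)]).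

Definition ILL : \bar R :=
  if 0 < low_price_prob then (- ln low_price_prob)%:E else +oo%E.

End liquidity.

(* Main.v *)
(* With t = (1 - s0) V(rho) above the lower value, the price is below t exactly
   when at most M - N_I noise traders have an estimate >= t.  By thinning, their
   number is Poisson of mean lambda * dT * p, where
   p = (s0 + (1 - s0) rho(c)) / c is the probability that a uniform estimate is
   >= t; so F is a Poisson distribution function at M - N_I, and it strictly
   decreases in the mean.  The mean strictly increases with lambda, and it
   strictly decreases with c because s0 / c is nonincreasing and, f being strictly
   concave and positive, rho(c) / c strictly decreases.  When s_bar(c2) <= s0 the
   threshold is at most the lower value, hence F(c2) = 0 and ILL(c2) = +oo. *)
Require Import Defs.
From HB Require Import structures.
From mathcomp Require Import all_boot all_order all_algebra.
From mathcomp Require Import all_classical all_reals all_analysis.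
From mathcomp Require Import ring lra.

Set Implicit Arguments.
Unset Strict Implicit.
Unset Printing Implicit Defensive.

Import Order.TTheory GRing.Theory Num.Theory.
Import numFieldNormedType.Exports.

Local Open Scope classical_set_scope.
Local Open Scope ring_scope.

(** * Order statistics and concave functions *)

Lemma nth_sorted_ge_lt (R : realDomainType) (s : seq R) (M : nat) (t : R) :
  sorted >=%R s -> (M < size s)%N ->
  (s`_M < t) = (count (>= t) s <= M)%N.
Proof.
elim: s M => [|x s IH] [|M] //= xs.
  move=> _; have /allP xmin := order_path_min (rev_trans le_trans) xs.
  rewrite leqNgt addn_gt0 -has_count negb_or lt0b -ltNge.
  case: (ltP x t) => //= xt; apply/esym/hasPn => y /xmin /= yx.
  by rewrite -ltNge (le_lt_trans yx).
move=> Ms; rewrite IH ?(path_sorted xs)//.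
(* If [t <= x], the head adds one to both the index and the count. If [x < t], no later entry
   reaches [t], so the count is 0 and both bounds hold. *)
case: (leP t x) => //= xt; rewrite add0n.
have /allP xmin := order_path_min (rev_trans le_trans) xs.
suff -> : count (>= t) s = 0%N by [].
apply/eqP; rewrite -leqn0 leqNgt -has_count; apply/hasPn => y /xmin /= yx.
by rewrite -ltNge (le_lt_trans yx).
Qed.

(** The tangent at [a] has slope at most [f a / a], and beyond [a] the graph lies strictly below it.
    Nothing is known of [f] at 0: positivity to the right of 0 takes the place of the usual
    condition [0 <= f 0]. *)
Lemma ratio_lt_of_concave (R : realType) (f : R -> R) (a b : R) :
  (forall x, 0 < x < b -> 0 < f x) ->
  (forall x, 0 < x <= b -> derivable f x 1) ->
  (forall x y, 0 < x -> x < y -> y <= b -> derive1 f y < derive1 f x) ->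
  0 < a -> a < b -> f b / b < f a / a.
Proof.
move=> f0 df f'decr a0 ab.
have slope x y : 0 < x -> x < y -> y <= b ->
    exists2 z, x < z < y & f y - f x = derive1 f z * (y - x).
  move=> x0 xy yb.
  have [||z] := @MVT R f (derive1 f) x y xy.
  - move=> z; rewrite in_itv/= => /andP[xz zy].
    rewrite derive1E; apply/derivableP/df.
    by rewrite (lt_trans x0 xz) (ltW (lt_le_trans zy yb)).
  - apply: derivable_within_continuous => z; rewrite in_itv/= => /andP[xz zy].
    by apply: df; rewrite (lt_le_trans x0 xz) (le_trans zy yb).
  - by rewrite in_itv/= => zxy fxy; exists z.
have a_in : 0 < a < b by rewrite a0.
(* Otherwise the tangent at [a] vanishes at some [e] in [(0, a)], and strict concavity puts [f e]
   below it, hence below 0. *)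
have tangent : derive1 f a * a <= f a.
  rewrite leNgt; apply/negP => lt_fa.
  have f'a : 0 < derive1 f a.
    by rewrite -(pmulr_lgt0 _ a0) (lt_trans _ lt_fa)// f0.
  (* the zero of the tangent line at [a] *)
  pose e := a - f a / derive1 f a.
  have e0 : 0 < e by rewrite subr_gt0 ltr_pdivrMr// mulrC.
  have ea : e < a by rewrite ltrBlDr ltrDl divr_gt0// f0.
  have [z /andP[ez za] fz] := slope e a e0 ea (ltW ab).
  have f'z : derive1 f a < derive1 f z.
    by apply: f'decr; rewrite ?(lt_trans e0 ez)// ltW.
  have ae : 0 < a - e by rewrite subr_gt0.
  have fe : 0 < f e by apply: f0; rewrite e0 (lt_trans ea ab).
  have ae' : derive1 f a * (a - e) = f a.
    by rewrite /e opprB addrC subrK mulrC divfK// gt_eqF.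
  have : derive1 f a * (a - e) < derive1 f z * (a - e) by rewrite ltr_pM2r.
  by rewrite -fz ae'; lra.
have [z /andP[az zb] fz] := slope a b a0 ab (lexx _).
have f'z : derive1 f z < derive1 f a by apply: f'decr => //; exact: ltW.
have b0 := lt_trans a0 ab.
rewrite ltr_pdivrMr// mulrAC ltr_pdivlMr//.
have {}fz : f b = f a + derive1 f z * (b - a) by rewrite -fz addrC subrK.
have ba0 : 0 < b - a by rewrite subr_gt0.
(* With the tangent bound, [a * f b < a * f a + a * f'(a) * (b - a) <= b * f a]. *)
have : derive1 f z * (b - a) < derive1 f a * (b - a) by rewrite ltr_pM2r.
by rewrite fz; nra.
Qed.

(** * Poisson weights and distribution functions *)

Definition poisson_weight {R : realType} (mu : R) (k : nat) : R :=
  mu ^+ k / k`!%:R * expR (- mu).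

Definition poisson_cdf {R : realType} (K : nat) (mu : R) : R :=
  \sum_(k < K.+1) poisson_weight mu k.

Section poisson.
Context (R : realType).
Implicit Types (mu p : R) (k n : nat).

Lemma poisson_weight_ge0 mu k : 0 <= mu -> 0 <= poisson_weight mu k.
Proof.
by move=> mu0; rewrite /poisson_weight mulr_ge0 ?expR_ge0// divr_ge0 ?exprn_ge0.
Qed.

(** [poisson_prob] treats the zero rate apart, as a Dirac mass. The closed formula covers it through
    [0 ^+ 0 = 1], so that [lambda = 0] is an ordinary value below. *)
Lemma poisson_prob_set1 mu n : 0 <= mu ->
  poisson_prob mu 0%N [set n] = (poisson_weight mu n)%:E.
Proof.
rewrite le_eqVlt /poisson_prob => /predU1P[<-|mu0].
  rewrite ltxx diracE /poisson_weight oppr0 expR0 mulr1 expr0n.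
  case: n => [|n]; first by rewrite mem_set// fact0 divr1.
  by rewrite memNset// mul0r.
by rewrite mu0 esum_set1 /poisson_pmf ?mu0// lee_fin poisson_weight_ge0// ltW.
Qed.

(** The weight of [k + 1] has as derivative the weight of [k] minus that of [k + 1], so the sum
    telescopes. *)
Lemma is_derive_poisson_cdf K mu :
  is_derive mu 1 (poisson_cdf K) (- poisson_weight mu K).
Proof.
elim: K => [|K IH].
  have -> : poisson_cdf 0 = fun x : R => expR (- x).
    apply/funext => x; rewrite /poisson_cdf big_ord1 /poisson_weight expr0.
    by rewrite fact0 divr1 mul1r.
  apply: is_derive_eq.
  by rewrite mulrN1 /poisson_weight expr0 fact0 divr1 mul1r.
have dw : is_derive mu 1 (fun x : R => poisson_weight x K.+1)
    (poisson_weight mu K - poisson_weight mu K.+1).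
  have -> : (fun x : R => poisson_weight x K.+1) =
      (K.+1`!%:R^-1 : R) \*: ((id : R -> R) ^+ K.+1 * (expR \o -%R)).
    apply/funext => x; rewrite /poisson_weight/= mulrAC mulrC.
    by rewrite !fctE.
  apply: is_derive_eq.
  rewrite /poisson_weight /= !fctE.
  have K0 : K`!%:R != 0 :> R by rewrite pnatr_eq0 -lt0n fact_gt0.
  have K10 : 1 + K%:R != 0 :> R by rewrite nat1r pnatr_eq0.
  rewrite /GRing.scale/= factS natrM exprS -nat1r.
  by field; rewrite K0.
rewrite (_ : - poisson_weight mu K.+1 = - poisson_weight mu K +
  (poisson_weight mu K - poisson_weight mu K.+1)); last by rewrite addKr.
have -> : poisson_cdf K.+1 =
    (poisson_cdf K : R -> R) + (fun x : R => poisson_weight x K.+1).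
  by apply/funext => x; rewrite /poisson_cdf big_ord_recr.
exact: is_deriveD.
Qed.

Lemma poisson_cdf_decr K mu1 mu2 : 0 <= mu1 -> mu1 < mu2 ->
  poisson_cdf K mu2 < poisson_cdf K mu1.
Proof.
move=> mu10 mu12.
have dG (x : R) : derivable (poisson_cdf K : R -> R) x 1.
  by case: (is_derive_poisson_cdf K x).
(* At [mu1 = 0] the derivative vanishes when [0 < K]; this criterion asks for its sign only inside
   the interval. *)
apply: (@ltr0_derive1_lt_cc R (poisson_cdf K) mu1 mu2) => //.
- move=> x; rewrite in_itv/= => /andP[x1 _].
  rewrite derive1E (@derive_val _ _ _ _ _ _ _ (is_derive_poisson_cdf K x)).
  have x0 := le_lt_trans mu10 x1.
  rewrite oppr_lt0 /poisson_weight mulr_gt0 ?expR_gt0//.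
  by rewrite divr_gt0 ?exprn_gt0// ltr0n fact_gt0.
- by apply: derivable_within_continuous.
- by rewrite in_itv/= lexx ltW.
- by rewrite in_itv/= lexx ltW.
Qed.

Lemma poisson_cdf_gt0 K mu : 0 <= mu -> 0 < poisson_cdf K mu.
Proof.
move=> mu0; rewrite /poisson_cdf big_ord_recl/= ltr_pwDl//.
  by rewrite /poisson_weight expr0 fact0 divr1 mul1r expR_gt0.
by apply: sumr_ge0 => i _; exact: poisson_weight_ge0.
Qed.

(** The weights are the point masses of a probability on [nat]; countable additivity replaces the
    exponential series. *)
Lemma nneseries_poisson_weight mu : 0 <= mu ->
  (\sum_(0 <= n <oo) (poisson_weight mu n)%:E = 1)%E.
Proof.
move=> mu0; rewrite -(probability_setT (poisson_prob mu 0%N)).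
have -> : [set: nat] = \bigcup_n [set n].
  by apply/esym/seteqP; split=> // x _; exists x.
rewrite measure_semi_bigcup//; last by move=> i j _ _ [x [-> ->]].
by apply: eq_eseriesr => n _; exact/esym/poisson_prob_set1.
Qed.

(** Terms with [n < k] vanish. After the shift from [n] to [n + k], each term is the weight of [k]
    at [mu * p] times the weight of [n] at [mu * (1 - p)], and the latter weights sum to 1. *)
Lemma poisson_thinning mu p k : 0 <= mu -> 0 <= p <= 1 ->
  (\sum_(0 <= n <oo) (poisson_weight mu n *
     ('C(n, k)%:R * (p ^+ k * (1 - p) ^+ (n - k))))%:E =
   (poisson_weight (mu * p) k)%:E)%E.
Proof.
move=> mu0 /andP[p0 p1]; have q0 : 0 <= 1 - p by rewrite subr_ge0.
rewrite (nneseries_split 0%N k)/=; last first.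
  move=> n _; rewrite lee_fin mulr_ge0 ?poisson_weight_ge0//.
  by rewrite !mulr_ge0 ?exprn_ge0.
rewrite add0n big1_seq ?add0e; last first.
  move=> n; rewrite mem_index_iota => /andP[_ nk].
  by rewrite bin_small// mul0r mulr0.
rewrite -nneseries_addn; last first.
  move=> n; rewrite lee_fin mulr_ge0 ?poisson_weight_ge0//.
  by rewrite !mulr_ge0 ?exprn_ge0.
rewrite -[RHS]mule1 -(nneseries_poisson_weight (mulr_ge0 mu0 q0)).
rewrite -nneseriesZl; last first.
  by move=> n _; rewrite lee_fin poisson_weight_ge0// mulr_ge0.
apply: eq_eseriesr => n _; rewrite -EFinM; congr EFin.
rewrite /poisson_weight addnK.
have -> : - mu = - (mu * p) + - (mu * (1 - p)) by ring.
rewrite expRD exprD !exprMn.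
have -> : 'C(n + k, k)%:R = (n + k)`!%:R / (k`!%:R * n`!%:R) :> R.
  apply/(canRL (mulfK _)).
    by rewrite -natrM pnatr_eq0 -lt0n muln_gt0 !fact_gt0.
  by rewrite -!natrM -(bin_fact (leq_addl n k)) addnK.
have fact_neq0 i : i`!%:R != 0 :> R by rewrite pnatr_eq0 -lt0n fact_gt0.
by field; rewrite !fact_neq0.
Qed.

End poisson.

(** * Thinning of a Poisson number of independent trials *)

Section thinned_count.
Context d (T : measurableType d) (R : realType) (P : probability T R).
Variables (N : {RV P >-> nat}) (X : nat -> {RV P >-> R}).
Hypothesis indep : mutually_independent P (fun o : option nat =>
  if o is Some i then g_sigma_algebra_preimage (X i)
  else g_sigma_algebra_preimage N).
Variables (A : set R) (mu p : R).
Hypothesis mA : measurable A.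
Hypothesis mu0 : 0 <= mu.
Hypothesis P_X : forall i, P (X i @^-1` A) = p%:E.
Hypothesis P_N : forall n, P (N @^-1` [set n]) = (poisson_weight mu n)%:E.

Let hits (w : T) n := count (fun i => X i w \in A) (iota 0 n).

(** Independence gives the probability of an event that fixes which of the first [n] trials hit;
    fixing only how many hit gives a disjoint union of such events. *)
Let pattern n (B : {set 'I_n}) : set T :=
  [set w | N w = n /\ forall j : 'I_n, (X j w \in A) = (j \in B)].

Let patternE n (B : {set 'I_n}) : pattern B =
  (N @^-1` [set n]) `&`
  \bigcap_(j in [set: 'I_n]) (X j @^-1` (if j \in B then A else ~` A)).
Proof.
apply/seteqP; split=> [w [Nw Xw]|w [Nw Xw]]; split=> // j.
  move=> _ /=; have := Xw j; case: (j \in B) => /=; first by move/set_mem.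
  by move=> /negbT; rewrite notin_setE.
by have /= := Xw j I; case: ifP => _ XA; [rewrite mem_set|rewrite memNset].
Qed.

Let measurable_side n (B : {set 'I_n}) j : measurable (if j \in B then A else ~` A).
Proof. by case: ifP => _ //; exact: measurableC. Qed.

Let measurable_preim i D : measurable D -> measurable (X i @^-1` D).
Proof. by move=> mD; rewrite -[_ @^-1` _]setTI; exact: measurable_funP. Qed.

Let measurable_pattern n (B : {set 'I_n}) : measurable (pattern B).
Proof.
rewrite patternE; apply: measurableI.
  by rewrite -[_ @^-1` _]setTI; exact: measurable_funP.
apply: fin_bigcap_measurable; first exact: finite_finset.
by move=> j _; apply: measurable_preim; apply: measurable_side.
Qed.

Let prob_pattern n (B : {set 'I_n}) : P (pattern B) =
  (poisson_weight mu n * (p ^+ #|B| * (1 - p) ^+ (n - #|B|)))%:E.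
Proof.
pose J : seq (option nat) := None :: [seq Some (val j) | j <- enum 'I_n].
(* The independence clause wants a family on all of [option nat]: [insub] recovers the ordinal, and
   [setT] is a default for indices outside [J]. *)
pose E (o : option nat) : set T := match o with
  | None => N @^-1` [set n]
  | Some i => if (insub i : option 'I_n) is Some j
              then X j @^-1` (if j \in B then A else ~` A) else setT
  end.
have EE (j : 'I_n) : E (Some (val j)) = X j @^-1` (if j \in B then A else ~` A).
  by rewrite /E valK.
have uJ : uniq J.
  rewrite /J/= map_inj_uniq ?enum_uniq ?andbT; last by move=> i j [/val_inj].
  by apply/mapP => -[].
have := @indep J E uJ.
rewrite /J big_cons big_map big_enum.
have -> : \bigcap_(i in [set` J]) E i = pattern B.
  rewrite patternE; apply/seteqP; split=> [w Ew|w [Nw Xw]].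
    split; first by apply: (Ew None); rewrite /= mem_head.
    move=> j _; rewrite -EE; apply: Ew => /=.
    by rewrite in_cons/=; apply/mapP; exists j; rewrite ?mem_enum.
  move=> o /=; rewrite in_cons => /predU1P[->//|/mapP[j _ ->]].
  by rewrite EE; exact: Xw.
move=> ->; last first.
  move=> o; rewrite in_cons => /predU1P[->|/mapP[j _ ->]].
    by exists [set n]; rewrite ?setTI.
  exists (if j \in B then A else ~` A); last by rewrite setTI; exact/esym/EE.
  by apply: measurable_side.
rewrite P_N (eq_bigr (fun j => (if j \in B then p else 1 - p)%:E)); last first.
  move=> j _; rewrite EE; case: ifP => _; first exact: P_X.
  by rewrite preimage_setC probability_setC ?P_X//; exact: measurable_preim.
rewrite prodEFin -EFinM (bigID (mem B))/=.
rewrite (eq_bigr (fun=> p)); last by move=> j ->.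
rewrite [X in (_ * (_ * X))%:E = _](eq_bigr (fun=> 1 - p)); last first.
  by move=> j /negbTE ->.
rewrite !prodr_const; congr (_ * (_ * _ ^+ _))%:E.
by have := cardC B; rewrite card_ord => /(canRL (addKn _)) <-; apply: eq_card.
Qed.

Let hits_card w n : hits w n = #|[set j : 'I_n | X j w \in A]%SET|.
Proof.
rewrite /hits -val_enum_ord count_map -sum1_count big_enum_cond -sum1_card.
by apply: eq_bigl => j; rewrite finset.in_set.
Qed.

Let hits_pattern n k : [set w | N w = n /\ hits w n = k] =
  \bigcup_(B in [set` enum [set B : {set 'I_n} | #|B| == k]%SET]) pattern B.
Proof.
apply/seteqP; split=> [w [Nw hw]|w [B /=]].
  exists [set j : 'I_n | X j w \in A]%SET.
    by rewrite /= mem_enum finset.in_set -hits_card hw.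
  by split=> // j; rewrite finset.in_set.
rewrite mem_enum finset.in_set => /eqP Bk [Nw XB]; split=> //.
by rewrite hits_card -Bk; apply: eq_card => j; rewrite finset.in_set XB.
Qed.

(** There are ['C(n, k)] patterns with [k] hits, all equally likely, and a point determines its
    pattern. *)
Let prob_hits_n n k : P [set w | N w = n /\ hits w n = k] =
  (poisson_weight mu n * ('C(n, k)%:R * (p ^+ k * (1 - p) ^+ (n - k))))%:E.
Proof.
rewrite hits_pattern measure_fin_bigcup//; last first.
  move=> B1 B2 _ _ [w [[_ w1] [_ w2]]].
  by apply/setP => j; rewrite -w1 w2.
rewrite -fsbig_seq ?enum_uniq//= big_enum/=.
under eq_bigr => B; first rewrite finset.in_set => /eqP Bk.
  rewrite prob_pattern Bk; over.
rewrite sumEFin sumr_const card_draws card_ord.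
by rewrite -mulr_natl; congr EFin; ring.
Qed.

Let measurable_hits_n n k : measurable [set w | N w = n /\ hits w n = k].
Proof. by rewrite hits_pattern; exact: fin_bigcup_measurable. Qed.

Let hitsE k : [set w | hits w (N w) = k] =
  \bigcup_n [set w | N w = n /\ hits w n = k].
Proof.
apply/seteqP; split=> [w hw|w [n _ [<- //]]].
by exists (N w).
Qed.

Let measurable_hits k : measurable [set w | hits w (N w) = k].
Proof. by rewrite hitsE; exact: bigcup_measurable. Qed.

(** Summing over the values [n] of [N] gives the series of [poisson_thinning]. *)
Let prob_hits k : 0 <= p <= 1 ->
  P [set w | hits w (N w) = k] = (poisson_weight (mu * p) k)%:E.
Proof.
move=> p01; rewrite hitsE measure_semi_bigcup//; first last.
- exact: bigcup_measurable.
- by move=> i j _ _ [w [[<- _] [<- _]]].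
rewrite -poisson_thinning//; apply: eq_eseriesr => n _.
exact: prob_hits_n.
Qed.

Let hits_leE K : [set w | (hits w (N w) <= K)%N] =
  \big[setU/set0]_(k < K.+1) [set w | hits w (N w) = k].
Proof.
rewrite -(bigcup_mkord K.+1 (fun k => [set w | hits w (N w) = k])) /=.
apply/seteqP; split=> [w hw|w [k /= kK hk]]; first by exists (hits w (N w)).
by rewrite /= hk.
Qed.

Lemma measurable_thinned_count_le K :
  measurable [set w | (count (fun i => X i w \in A) (iota 0 (N w)) <= K)%N].
Proof. by have := hits_leE K => ->; apply: bigsetU_measurable. Qed.

Lemma prob_thinned_count_le K : 0 <= p <= 1 ->
  P [set w | (count (fun i => X i w \in A) (iota 0 (N w)) <= K)%N] =
  (poisson_cdf K (mu * p))%:E.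
Proof.
move=> p01; have := hits_leE K => ->.
rewrite measure_bigsetU_ord//; last first.
  by move=> i j _ _ [w [/= hi hj]]; apply/val_inj; rewrite /= -hi -hj.
rewrite /poisson_cdf -sumEFin; apply: eq_bigr => k _.
exact: prob_hits.
Qed.

End thinned_count.

(** * Probability of a low price *)

Lemma uniform_prob_itvcy (R : realType) (a b t : R) (ab : a < b) :
  a <= t <= b -> uniform_prob ab `[t, +oo[ = ((b - t) / (b - a))%:E.
Proof.
move=> /andP[at_ tb]; rewrite /uniform_prob integral_uniform_pdf.
have -> : `[t, +oo[ `&` `[a, b] = `[t, b]%classic.
  apply/seteqP; split=> x /=; rewrite !in_itv/= ?andbT.
    by move=> [-> /andP[_ ->]].
  by move=> /andP[tx ->]; rewrite tx (le_trans at_ tx).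
rewrite (eq_integral (cst ((b - a)^-1)%:E)); last first.
  move=> x; rewrite inE/= in_itv/= => /andP[tx xb].
  by rewrite /uniform_pdf (le_trans at_ tx) xb.
rewrite integral_cst//= lebesgue_measure_itv/= lte_fin.
(* For [t = b] the interval is a single point and both sides are 0. *)
case: ltgtP tb => // [tb _|-> _]; last by rewrite mule0 subrr mul0r.
by rewrite -EFinB -EFinM mulrC.
Qed.

Lemma s_bar_lt1 (R : realType) (rho : R -> R) (c : R) :
  rho c <= c -> c < 1 -> s_bar rho c < 1.
Proof.
move=> rc c1; rewrite /s_bar ltr_pdivrMr ?subr_gt0 ?(le_lt_trans rc)//.
by rewrite mul1r ltrD2r.
Qed.

Section market_liquidity.
Context (R : realType) (rho : R -> R) (NI M : nat) (s0 : R).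
Context (Vbar dT c lambda : R) (m : market Vbar dT c lambda).
Hypotheses (Vbar_gt0 : 0 < Vbar) (dT_gt0 : 0 < dT) (NI_le_M : (NI <= M)%N).
Hypotheses (c01 : 0 < c < 1) (rho_bounds : 0 <= rho c <= c).
Hypotheses (s00 : 0 <= s0) (lambda_ge0 : 0 <= lambda).

Let t : R := (1 - s0) * fair_value Vbar (rho c).

Let rho_lt1 : rho c < 1.
Proof.
by case/andP: c01 => _; case/andP: rho_bounds => _; exact: le_lt_trans.
Qed.

Let c_gt0 : 0 < c. Proof. by case/andP: c01. Qed.

Let t_le_fair : t <= fair_value Vbar (rho c).
Proof.
rewrite /t /fair_value ler_piMl ?gerBl//.
by rewrite mulr_ge0 ?subr_ge0 ?(ltW rho_lt1) ?(ltW Vbar_gt0).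
Qed.

Let fair_le_Vbar : fair_value Vbar (rho c) <= Vbar.
Proof.
have /andP[r0 _] := rho_bounds.
by rewrite /fair_value ler_piMl ?gerBl// ?(ltW Vbar_gt0).
Qed.

Let lower_lt_Vbar : lower_value Vbar c < Vbar.
Proof. by rewrite /lower_value gtr_pMl// gtrBl. Qed.

Let estimates_ge (w : outcome m) x :
  count (>= x) (estimates rho NI w) =
  ((x <= fair_value Vbar (rho c))%R * NI +
   count (fun i => noise_estimate m i w \in `[x, +oo[%classic)
     (iota 0 (noise_count m w)))%N.
Proof.
rewrite /estimates count_cat count_nseq/= count_map; congr addn.
by apply: eq_count => i; rewrite /= mem_setE in_itv/= andbT.
Qed.

(** Every informed estimate is at least [t], so informed traders use up [NI] of the [M] estimates
    allowed to reach [t]; as [NI <= M], the truncated subtraction is exact. The last branch is the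
    case of at most [M] traders, where the price is the lower value. *)
Let market_price_lt (w : outcome m) :
  (market_price rho NI M w < t) =
  if (M - NI < noise_count m w)%N then
    (count (fun i => noise_estimate m i w \in `[t, +oo[%classic)
     (iota 0 (noise_count m w)) <= M - NI)%N
  else lower_value Vbar c < t.
Proof.
rewrite /market_price size_sort size_cat size_nseq size_map size_iota.
rewrite ltn_subLR//; case: ifPn => // Msize.
rewrite nth_sorted_ge_lt ?sort_sorted//; last first.
- by rewrite size_sort size_cat size_nseq size_map size_iota.
- exact: ge_total.
by rewrite count_sort estimates_ge t_le_fair mul1n -leq_subRL.
Qed.

Let prob_noise_count n :
  Pr m (noise_count m @^-1` [set n]) = (poisson_weight (lambda * dT) n)%:E.
Proof.
rewrite -poisson_prob_set1 ?mulr_ge0 ?(ltW dT_gt0)//.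
by rewrite -(noise_count_poisson m).
Qed.

(** Stated for a general set since it also serves for [setT], where every noise trader is
    counted. *)
Let low_count_prob A p : measurable A -> 0 <= p <= 1 ->
  (forall i, Pr m (noise_estimate m i @^-1` A) = p%:E) ->
  Pr m [set w | (count (fun i => noise_estimate m i w \in A)
    (iota 0 (noise_count m w)) <= M - NI)%N] =
  (poisson_cdf (M - NI) (lambda * dT * p))%:E.
Proof.
move=> mA p01 Xp; apply: prob_thinned_count_le => //.
- exact: noise_independent.
- by rewrite mulr_ge0 ?(ltW dT_gt0).
Qed.

Lemma low_price_probE : s0 < s_bar rho c ->
  low_price_prob rho NI M s0 m =
  poisson_cdf (M - NI) (lambda * dT * ((s0 + (1 - s0) * rho c) / c)).
Proof.
move=> s0_sbar; move: (s0_sbar); rewrite /s_bar ltr_pdivlMr ?subr_gt0// => s0_lt.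
(* Multiplied out, [s0 < s_bar rho c] says [1 - c < (1 - s0) * (1 - rho c)]. *)
have lower_t : lower_value Vbar c < t.
  by rewrite /t /fair_value mulrA /lower_value ltr_pM2r//; nra.
rewrite /low_price_prob.
have -> : [set w | market_price rho NI M w < (1 - s0) * fair_value Vbar (rho c)] =
  [set w | (count (fun i => noise_estimate m i w \in `[t, +oo[%classic)
    (iota 0 (noise_count m w)) <= M - NI)%N].
  (* With at most [M - NI] noise traders both conditions hold: the price is the lower value, and the
     count is at most the number of noise traders. *)
  apply/seteqP; split=> w /=; rewrite -/t market_price_lt lower_t;
    case: ltnP => // countM _.
  by rewrite (leq_trans (count_size _ _))// size_iota.
rewrite (@low_count_prob _ ((s0 + (1 - s0) * rho c) / c))//.
  have /andP[_ c1] := c01; have /andP[r0 rc] := rho_bounds.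
  have s01 : s0 < 1 := lt_trans s0_sbar (s_bar_lt1 rc c1).
  rewrite ler_pdivrMr// mul1r divr_ge0 ?(ltW c_gt0)//=; first by nra.
  by rewrite addr_ge0// mulr_ge0// subr_ge0 ltW.
move=> i; have [ab Xab] := noise_estimate_uniform m.
rewrite -[LHS]/(distribution _ _ _) Xab// uniform_prob_itvcy; last first.
  by rewrite (ltW lower_t) (le_trans t_le_fair).
(* The ratio of lengths is [(Vbar - t) / (c * Vbar)], from which [Vbar] cancels. *)
congr EFin; rewrite /t /lower_value /fair_value.
field; rewrite gt_eqF//= gt_eqF//.
by rewrite subr_gt0 gtr_pMl// gtrBl.
Qed.

(* Almost every estimate is [>= t] here, so "at most [M - NI] estimates are
   [>= t]" and "at most [M - NI] noise traders" have the same probability; the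
   price is below [t] on the difference of these two events. *)
Lemma low_price_prob_eq0 : s_bar rho c <= s0 ->
  low_price_prob rho NI M s0 m = 0.
Proof.
rewrite /s_bar ler_pdivrMr ?subr_gt0// => s0_ge.
have t_lower : t <= lower_value Vbar c.
  by rewrite /t /fair_value mulrA /lower_value ler_pM2r//; nra.
pose low (A : set R) := [set w | (count (fun i => noise_estimate m i w \in A)
    (iota 0 (noise_count m w)) <= M - NI)%N].
have lowT : low setT = [set w | (noise_count m w <= M - NI)%N].
  apply/seteqP; split=> w; rewrite /low/= (eq_count (a2 := predT));
    by [rewrite count_predT size_iota|move=> i; rewrite /= in_setT].
have mlow A : measurable A -> measurable (low A).
  by move=> mA; apply: measurable_thinned_count_le.
have Pt i : Pr m (noise_estimate m i @^-1` `[t, +oo[) = 1%:E.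
  have [ab Xab] := noise_estimate_uniform m.
  rewrite -[LHS]/(distribution _ _ _) Xab// /uniform_prob integral_uniform_pdf1//.
  by move=> x /=; rewrite !in_itv/= andbT => /andP[+ _]; exact: le_trans.
have p1 : 0 <= (1 : R) <= 1 by rewrite ler01 lexx.
rewrite /low_price_prob.
have -> : [set w | market_price rho NI M w < (1 - s0) * fair_value Vbar (rho c)] =
    low `[t, +oo[%classic `\` low setT.
  rewrite lowT; apply/seteqP; split=> w /=; rewrite -/t market_price_lt.
    case: ltnP => [Mn lowM|_ /(le_lt_trans t_lower)]; last by rewrite ltxx.
    by split=> //; apply/negP; rewrite -ltnNge.
  by move=> [lowM /negP]; rewrite -ltnNge => ->.
have sub : low setT `<=` low `[t, +oo[%classic.
  rewrite lowT => w /=; apply: leq_trans.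
  by rewrite (leq_trans (count_size _ _))// size_iota.
rewrite measureD ?setIidr//; first last.
- by rewrite ltey_eq fin_num_measure//; exact: mlow.
- exact: mlow.
- exact: mlow.
rewrite [X in fine (X - _)%E](low_count_prob _ p1 Pt)//.
rewrite [X in fine (_ - X)%E](@low_count_prob setT 1)//.
  by rewrite -EFinB subrr.
by move=> i; rewrite preimage_setT probability_setT.
Qed.

End market_liquidity.

(** Strict growth of the mean in [lambda] rests on this factor; [0 < rho c] keeps it positive even
    for [s0 = 0]. *)
Lemma high_estimate_prob_gt0 (R : realType) (rho : R -> R) (c s0 : R) :
  0 < rho c -> rho c <= c -> c < 1 -> 0 <= s0 -> s0 < s_bar rho c ->
  0 < (s0 + (1 - s0) * rho c) / c.
Proof.
move=> r0 rc c1 s00 s0_lt; apply: divr_gt0; last exact: lt_le_trans rc.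
rewrite ltr_wpDl// mulr_gt0// subr_gt0.
exact: lt_trans s0_lt (s_bar_lt1 rc c1).
Qed.

(** * Comparison of the liquidity indices *)

Theorem proposition3 (R : realType) (Vbar dT theta : R) (NI M : nat)
  (f : R -> R)
  (Vbar_gt0 : 0 < Vbar) (dT_gt0 : 0 < dT)
  (M_ge1 : (1 <= M)%N) (NI_le_M : (NI <= M)%N)
  (theta_gt0 : 0 < theta) (theta_lt1 : theta < 1)
  (f_gt0 : forall c : R, 0 < c < 1 -> 0 < f c)
  (f_derivable : forall c : R, 0 < c < 1 -> derivable f c 1)
  (f'_derivable : forall c : R, 0 < c < 1 -> derivable (derive1 f) c 1)
  (f'_gt0 : forall c : R, 0 < c < 1 -> 0 < derive1 f c)
  (f''_lt0 : forall c : R, 0 < c < 1 -> derive1n 2 f c < 0)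
  (rho_bounds : forall c : R, 0 < c < 1 -> 0 <= agency_cost theta f c <= c) :
  let rho := agency_cost theta f in
  (forall c s0 lambda1 lambda2 : R,
     0 < c < 1 -> 0 <= s0 < s_bar rho c -> 0 <= lambda1 -> lambda1 < lambda2 ->
     forall (m1 : market Vbar dT c lambda1) (m2 : market Vbar dT c lambda2),
       (ILL rho NI M s0 m1 < ILL rho NI M s0 m2)%E)
  /\
  (forall lambda c1 c2 s0 : R,
     0 < lambda -> 0 < c2 -> c2 < c1 -> c1 < 1 -> 0 <= s0 < s_bar rho c1 ->
     forall (m1 : market Vbar dT c1 lambda) (m2 : market Vbar dT c2 lambda),
       (ILL rho NI M s0 m2 > ILL rho NI M s0 m1)%E).
Proof.
move=> rho.
have rho_gt0 c : 0 < c < 1 -> 0 < rho c.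
  by move=> c01; rewrite mulr_gt0 ?f_gt0// divr_gt0// subr_gt0.
have rho_lec c : 0 < c < 1 -> rho c <= c by move=> /rho_bounds/andP[].
have f'_decr x y : 0 < x -> x < y -> y < 1 -> derive1 f y < derive1 f x.
  move=> x0 xy y1.
  apply: (@ltr0_derive1_lt_cc R (derive1 f) x y) => //.
  - move=> z; rewrite in_itv/= => /andP[xz zy]; apply: f'_derivable.
    by rewrite (lt_trans x0 xz) (lt_trans zy y1).
  - move=> z; rewrite in_itv/= => /andP[xz zy]; apply: (f''_lt0 z).
    by rewrite (lt_trans x0 xz) (lt_trans zy y1).
  - apply: derivable_within_continuous => z; rewrite in_itv/= => /andP[xz zy].
    by apply: f'_derivable; rewrite (lt_le_trans x0 xz) (le_lt_trans zy y1).
  - by rewrite in_itv/= lexx ltW.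
  - by rewrite in_itv/= lexx ltW.
have ratio_decr c1 c2 : 0 < c2 -> c2 < c1 -> c1 < 1 -> rho c1 / c1 < rho c2 / c2.
  move=> c20 c21 c11.
  rewrite /rho /agency_cost -!(mulrA _ (f _)) ltr_pM2l ?divr_gt0 ?subr_gt0//.
  apply: ratio_lt_of_concave => //.
  - by move=> x /andP[x0 xc]; rewrite f_gt0// x0 (lt_trans xc).
  - by move=> x /andP[x0 xc]; apply: f_derivable; rewrite x0 (le_lt_trans xc).
  - by move=> x y x0 xy yc; apply: f'_decr => //; exact: le_lt_trans c11.
split.
  move=> c s0 lambda1 lambda2 c01 /andP[s00 s0c] l10 l12 m1 m2.
  have l20 : 0 <= lambda2 by rewrite (le_trans l10)// ltW.
  have [c0 c1] := andP c01.
  have p0 := high_estimate_prob_gt0 (rho_gt0 c c01) (rho_lec c c01) c1 s00 s0c.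
  have mean_ge0 l : 0 <= l -> 0 <= l * dT * ((s0 + (1 - s0) * rho c) / c).
    by move=> l_ge0; apply: mulr_ge0; [exact: mulr_ge0 (ltW _)|exact: ltW].
  (* [s_bar rho c] does not involve [lambda], so both probabilities are Poisson distribution
     functions; being positive, they give finite indices. *)
  rewrite /ILL !low_price_probE ?rho_bounds// !poisson_cdf_gt0 ?mean_ge0//.
  rewrite lte_fin ltrN2 ltr_ln ?posrE ?poisson_cdf_gt0 ?mean_ge0//.
  by rewrite poisson_cdf_decr ?mean_ge0// !ltr_pM2r.
move=> lambda c1 c2 s0 l0 c20 c21 c11 /andP[s00 s0c1] m1 m2.
have c10 : 0 < c1 by exact: lt_trans c21.
have c1_in : 0 < c1 < 1 by rewrite c10.
have c2_in : 0 < c2 < 1 by rewrite c20 (lt_trans c21).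
have [_ c2_lt1] := andP c2_in.
have p1 := high_estimate_prob_gt0 (rho_gt0 c1 c1_in) (rho_lec c1 c1_in) c11 s00 s0c1.
have mean1 : 0 <= lambda * dT * ((s0 + (1 - s0) * rho c1) / c1).
  by apply: mulr_ge0; [exact: mulr_ge0 (ltW _) (ltW _)|exact: ltW].
rewrite /ILL (@low_price_probE R rho NI M s0 Vbar dT c1 lambda m1)
  ?rho_bounds ?(ltW l0)//.
rewrite poisson_cdf_gt0//.
(* Only [s_bar rho c1] is known to exceed [s0]. If [s_bar rho c2] does not, the index is infinite at
   [c2] and finite at [c1]. *)
have [s0c2|s0c2] := ltP s0 (s_bar rho c2); last first.
  by rewrite low_price_prob_eq0 ?rho_bounds ?(ltW l0)// ltxx ltry.
have p2 := high_estimate_prob_gt0 (rho_gt0 c2 c2_in) (rho_lec c2 c2_in) c2_lt1 s00 s0c2.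
have mean2 : 0 <= lambda * dT * ((s0 + (1 - s0) * rho c2) / c2).
  by apply: mulr_ge0; [exact: mulr_ge0 (ltW _) (ltW _)|exact: ltW].
rewrite low_price_probE ?rho_bounds ?(ltW l0)// poisson_cdf_gt0//.
rewrite lte_fin ltrN2 ltr_ln ?posrE ?poisson_cdf_gt0//.
apply: poisson_cdf_decr => //.
(* Split the factor into [s0 / c] and [(1 - s0) * (rho c / c)]. The first term is only weakly
   monotone, since [s0] may be 0; strictness comes from the second, where [s0 < 1]. *)
rewrite ltr_pM2l ?mulr_gt0// !(mulrDl s0) -!(mulrA (1 - s0)).
apply: ler_ltD; first by rewrite ler_wpM2l// lef_pV2 ?posrE// ltW.
rewrite ltr_pM2l ?ratio_decr// subr_gt0.
exact: lt_trans s0c1 (s_bar_lt1 (rho_lec c1 c1_in) c11).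
Qed.
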